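(* Let $\mathsf H:\mathbb R^d\to\mathbb R$ be a smooth function. Let $f:[0,\infty)\times\mathbb R^d\to\mathbb R$ be Lipschitz and convex. Suppose that $f$ satisfies $$\partial_tf-\mathsf H(\nabla f)=0$$ on a dense subset of $(0,\infty)\times\mathbb R^d$, and that the initial condition $f(0,\cdot)$ is $C^1$. Then $f$ is a viscosity solution to $\partial_tf-\mathsf H(\nabla f)=0$ on $[0,\infty)\times\mathbb R^d$ with initial condition $f(0,\cdot)$.
   Context: $\partial_t$ is the derivative in the first variable and $\nabla$ the gradient in the $\mathbb R^d$ variable. ''$f$ satisfies the equation on a dense subset'' means that the set of points $(t,x)\in(0,\infty)\times\mathbb R^d$ at which $f$ is differentiable and $(\partial_tf-\mathsf H(\nabla f))(t,x)=0$ is dense in $(0,\infty)\times\mathbb R^d$. A continuous function $f:[0,\infty)\times\mathbb R^d\to\mathbb R$ is a viscosity subsolution (resp. supersolution) if for every $(t,h)\in(0,\infty)\times\mathbb R^d$ and every smooth $\phi:(0,\infty)\times\mathbb R^d\to\mathbb R$ such that $f-\phi$ has a local maximum (resp. local minimum) at $(t,h)$, one has $(\partial_t\phi-\mathsf H(\nabla\phi))(t,h)\le0$ (resp. $\ge0$). It is a viscosity solution if it is both a viscosity subsolution and a viscosity supersolution. *)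

(* Defs.v *)
From mathcomp Require Import all_boot all_order all_algebra.
From mathcomp Require Import all_classical all_reals all_analysis.

Set Implicit Arguments.
Unset Strict Implicit.
Unset Printing Implicit Defensive.

Import Order.TTheory GRing.Theory Num.Theory.
Import numFieldNormedType.Exports.

Local Open Scope classical_set_scope.
Local Open Scope ring_scope.

(* C^k on an open set U of a finite-dimensional space; the values of f off U are
   irrelevant because U is open. In finite dimension, x |-> Df(x) is C^k iff
   x |-> Df(x) v is C^k for every vector v. *)
Fixpoint Ck_on (R : realType) (V : normedModType R) (k : nat) (U : set V)
    (f : V -> R) : Prop :=
  if k is k'.+1 then
    (forall x, U x -> differentiable f x) /\
    (forall v : V, Ck_on k' U (fun x => 'D_v f x))
  else forall x, U x -> {for x, continuous f}.

Definition smooth_on (R : realType) (V : normedModType R) (U : set V)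
    (f : V -> R) : Prop :=
  forall k, Ck_on k U f.

(* Functions on [0, oo[ x R^d are total functions on R * 'rV_d whose values at
   negative times are never used. *)
Definition closed_spacetime (R : realType) (d : nat) : set (R * 'rV[R]_d) :=
  [set z | 0 <= z.1].

Definition open_spacetime (R : realType) (d : nat) : set (R * 'rV[R]_d) :=
  [set z | 0 < z.1].

Definition time_deriv (R : realType) (d : nat) (f : R * 'rV[R]_d -> R)
    (z : R * 'rV[R]_d) : R :=
  'D_(1, 0) f z.

Definition space_grad (R : realType) (d : nat) (f : R * 'rV[R]_d -> R)
    (z : R * 'rV[R]_d) : 'rV[R]_d :=
  \row_(i < d) 'D_(0, delta_mx 0 i) f z.

Definition HJ_residual (R : realType) (d : nat) (H : 'rV[R]_d -> R)
    (f : R * 'rV[R]_d -> R) (z : R * 'rV[R]_d) : R :=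
  time_deriv f z - H (space_grad f z).

Definition satisfies_on_dense_subset (R : realType) (d : nat)
    (H : 'rV[R]_d -> R) (f : R * 'rV[R]_d -> R) : Prop :=
  @open_spacetime R d `<=`
    closure [set z | [/\ open_spacetime z, differentiable f z
                       & HJ_residual H f z = 0]].

(* For z in the open set U, a local extremum relative to U is one relative to the
   whole space. *)
Definition local_max_at (R : realType) (T : topologicalType) (g : T -> R)
    (z : T) : Prop :=
  \forall y \near z, g y <= g z.

Definition local_min_at (R : realType) (T : topologicalType) (g : T -> R)
    (z : T) : Prop :=
  \forall y \near z, g z <= g y.

Definition viscosity_subsolution (R : realType) (d : nat)
    (H : 'rV[R]_d -> R) (f : R * 'rV[R]_d -> R) : Prop :=
  {within @closed_spacetime R d, continuous f} /\
  forall (z : R * 'rV[R]_d) (phi : R * 'rV[R]_d -> R),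
    open_spacetime z -> smooth_on (@open_spacetime R d) phi ->
    local_max_at (fun y => f y - phi y) z ->
    HJ_residual H phi z <= 0.

Definition viscosity_supersolution (R : realType) (d : nat)
    (H : 'rV[R]_d -> R) (f : R * 'rV[R]_d -> R) : Prop :=
  {within @closed_spacetime R d, continuous f} /\
  forall (z : R * 'rV[R]_d) (phi : R * 'rV[R]_d -> R),
    open_spacetime z -> smooth_on (@open_spacetime R d) phi ->
    local_min_at (fun y => f y - phi y) z ->
    0 <= HJ_residual H phi z.

Definition viscosity_solution (R : realType) (d : nat)
    (H : 'rV[R]_d -> R) (f : R * 'rV[R]_d -> R) : Prop :=
  viscosity_subsolution H f /\ viscosity_supersolution H f.

Definition viscosity_solution_with_initial (R : realType) (d : nat)
    (H : 'rV[R]_d -> R) (u0 : 'rV[R]_d -> R) (f : R * 'rV[R]_d -> R) : Prop :=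
  viscosity_solution H f /\ forall x : 'rV[R]_d, f (0, x) = u0 x.

(* Main.v *)
Require Import Defs.
From mathcomp Require Import all_boot all_order all_algebra.
From mathcomp Require Import all_classical all_reals all_analysis.
From mathcomp Require Import ring lra.

Import Order.TTheory GRing.Theory Num.Theory.
Import numFieldNormedType.Exports.
Local Open Scope classical_set_scope.
Local Open Scope ring_scope.

(* Every point z of [0, oo[ x R^d, boundary included, carries a subgradient of f
   of the form (H q, q): take a cluster point of the gradients of f along the
   dense set, which are bounded because f is Lipschitz.

   Subsolution: a test function touching f from above at z has gradient (H q, q).

   Supersolution: the gradient (a, p) of a test function touching f from below at
   z = (t, h) is a subgradient of f at z. Let y minimise
   f(0, y) - p.y + eps |y - h|^2. Since f(0, .) is differentiable, its gradient at
   y is both p - 2 eps (y - h) and the q of a subgradient (H q, q) of f at (0, y).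
   Adding the two subgradient inequalities, from z to (0, y) and from (0, y) to z,
   gives a t >= H(q) t + 2 eps |y - h|^2 >= H(q) t, and q -> p as eps -> 0. *)

(** * One-sided difference quotients and subgradients of convex functions *)

(** Divide by [s] and let [s] tend to 0 from the right. The slack [K * s] absorbs second-order terms
    such as those of a quadratic penalty. *)
Lemma derive_ge {R : realType} {V : normedModType R} (g : V -> R) (z v : V)
    (c K : R) :
  derivable g z v ->
  (\forall s \near (0:R)^'+, s * (c - K * s) <= g (s *: v + z) - g z) ->
  c <= 'D_v g z.
Proof.
move=> dg ge_c.
have cvD : h^-1 *: (g (h *: v + z) - g z) @[h --> (0:R)^'+] --> 'D_v g z.
  by apply: cvg_dnbhs_at_right; exact: dg.
have cvc : (c - K * h) @[h --> (0 : R)^'+] --> c.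
  rewrite -[X in _ --> X]subr0 -[X in _ - X](mulr0 K).
  apply: cvg_at_right_filter.
  by apply: cvgB; [exact: cvg_cst|apply: cvgMr; exact: cvg_id].
apply: (ler_cvg_to cvc cvD).
near=> s.
have s0 : 0 < s by near: s; exact: nbhs_right_gt.
rewrite -[leLHS](mulKf (lt0r_neq0 s0)) ler_pM2l ?invr_gt0//.
near: s; exact: ge_c.
Unshelve. all: by end_near. Qed.

(** Both sides are odd in [v], so the bound at [- v] is the reverse inequality. *)
Lemma derive_eq_of_ge {R : realType} {V : normedModType R} (g : V -> R)
    (z : V) (l : V -> R) :
  differentiable g z -> (forall v, l (- v) = - l v) ->
  (forall v, l v <= 'D_v g z) -> forall v, 'D_v g z = l v.
Proof.
move=> dg lN l_le v; apply/eqP; rewrite eq_le l_le andbT.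
rewrite -[leRHS]opprK -lN lerNr.
by have := l_le (- v); rewrite !deriveE// linearN.
Qed.

Lemma near_segment {R : realType} {V : normedModType R} (z v : V) (P : set V) :
  (\forall y \near z, P y) -> \forall s \near (0 : R)^'+, P (s *: v + z).
Proof.
move=> zP.
suff : s *: v + z @[s --> (0 : R)^'+] --> z by exact.
apply: cvg_at_right_filter; rewrite -[X in _ --> X]add0r -(scale0r v).
by apply: cvgD; [apply: cvgZr_tmp; exact: cvg_id|exact: cvg_cst].
Qed.

(** Convexity bounds the increment of [f] along the segment from [z] to [w] by the chord, and the
    local minimum transfers this bound to [phi]. Taking [phi] equal to [f] shows that the gradient
    of [f] is itself a subgradient. *)
Lemma convex_local_min_subgradient {R : realType} {V : normedModType R}
    (A : set V) (f phi : V -> R) (z w : V) :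
  convex_function A f -> A z -> A w -> differentiable phi z ->
  local_min_at (fun y => f y - phi y) z ->
  f z + 'D_(w - z) phi z <= f w.
Proof.
move=> f_convex Az Aw dphi zmin.
(* The upper bound on the derivative of [phi] becomes a lower bound for [- phi]. *)
rewrite -lerBrDl -lerN2 -deriveN; last exact: diff_derivable.
apply: (derive_ge _ _ _ _ 0).
  by apply: derivableN; exact: diff_derivable.
near=> s.
have s0 : 0 < s by near: s; exact: nbhs_right_gt.
have s1 : s < 1 by near: s; exact: nbhs_right_lt.
have mins : f z - phi z <= f (s *: (w - z) + z) - phi (s *: (w - z) + z).
  by near: s; exact: near_segment zmin.
have /andP[s0' s1'] : (0 <= s) && (s <= 1) by rewrite !ltW.
have := f_convex (Itv01 s0' s1') w z (mem_set Aw) (mem_set Az).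
have -> : conv (Itv01 s0' s1') (w : convex_lmodType V) z = s *: (w - z) + z.
  rewrite /conv/= scalerBl scale1r scalerBr.
  by rewrite addrAC addrA.
rewrite convRE /= /unstable.onem !fctE => f_le.
lra.
Unshelve. all: by end_near. Qed.

(** * The Euclidean inner product on row vectors *)

Definition dotv {R : realType} {d : nat} (q x : 'rV[R]_d) : R :=
  \sum_(i < d) q 0 i * x 0 i.

Lemma dotvC {R : realType} {d : nat} (q x : 'rV[R]_d) :
  dotv q x = dotv x q.
Proof. by apply: eq_bigr => i _; rewrite mulrC. Qed.

Lemma dotvDr {R : realType} {d : nat} (q x y : 'rV[R]_d) :
  dotv q (x + y) = dotv q x + dotv q y.
Proof. by rewrite -big_split; apply: eq_bigr => i _; rewrite mxE mulrDr. Qed.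

Lemma dotvZr {R : realType} {d : nat} (a : R) (q x : 'rV[R]_d) :
  dotv q (a *: x) = a * dotv q x.
Proof. by rewrite mulr_sumr; apply: eq_bigr => i _; rewrite mxE mulrCA. Qed.

Lemma dotvr0 {R : realType} {d : nat} (q : 'rV[R]_d) : dotv q 0 = 0.
Proof. by rewrite -(scale0r 0) dotvZr mul0r. Qed.

Lemma dotvNr {R : realType} {d : nat} (q x : 'rV[R]_d) :
  dotv q (- x) = - dotv q x.
Proof. by rewrite -scaleN1r dotvZr mulN1r. Qed.

Lemma dotvDl {R : realType} {d : nat} (q x y : 'rV[R]_d) :
  dotv (x + y) q = dotv x q + dotv y q.
Proof. by rewrite dotvC dotvDr !(dotvC _ q). Qed.

Lemma dotvZl {R : realType} {d : nat} (a : R) (q x : 'rV[R]_d) :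
  dotv (a *: x) q = a * dotv x q.
Proof. by rewrite dotvC dotvZr dotvC. Qed.

Lemma dotvNl {R : realType} {d : nat} (q x : 'rV[R]_d) :
  dotv (- x) q = - dotv x q.
Proof. by rewrite dotvC dotvNr dotvC. Qed.

Lemma dotv_delta {R : realType} {d : nat} (q : 'rV[R]_d) (i : 'I_d) :
  dotv q (delta_mx 0 i) = q 0 i.
Proof.
rewrite /dotv (bigD1 i)//= mxE !eqxx mulr1 big1 ?addr0// => j ji.
by rewrite mxE eqxx (negbTE ji) mulr0.
Qed.

Lemma sqr_coord_le_dotv {R : realType} {d : nat} (q : 'rV[R]_d) (i : 'I_d) :
  q 0 i ^+ 2 <= dotv q q.
Proof.
rewrite /dotv (bigD1 i)//= -expr2 lerDl sumr_ge0// => j _.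
by rewrite -expr2 sqr_ge0.
Qed.

Lemma dotv_ge0 {R : realType} {d : nat} (q : 'rV[R]_d) : 0 <= dotv q q.
Proof. by apply: sumr_ge0 => i _; rewrite -expr2 sqr_ge0. Qed.

Lemma dotv_eq0 {R : realType} {d : nat} (q : 'rV[R]_d) :
  dotv q q <= 0 -> q = 0.
Proof.
move=> q_le0; apply/rowP => i; rewrite mxE; apply/eqP.
rewrite -sqrf_eq0 eq_le sqr_ge0 andbT.
exact: le_trans (sqr_coord_le_dotv q i) q_le0.
Qed.

Lemma cvg_dotv {R : realType} {d : nat} {T : Type} {F : set_system T}
    {FF : Filter F} (u v : T -> 'rV[R]_d) (a b : 'rV[R]_d) :
  u t @[t --> F] --> a -> v t @[t --> F] --> b ->
  dotv (u t) (v t) @[t --> F] --> dotv a b.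
Proof.
move=> ua vb; apply: cvg_big => [|i _]; first exact: add_continuous.
apply: cvgM.
  exact: cvg_comp ua (@coord_continuous _ _ _ 0 i a).
exact: cvg_comp vb (@coord_continuous _ _ _ 0 i b).
Qed.

(** * Derivatives, Lipschitz bounds and density in space-time *)

Lemma derive_spacetime {R : realType} {d : nat} (phi : R * 'rV[R]_d -> R)
    (z v : R * 'rV[R]_d) :
  differentiable phi z ->
  'D_v phi z = time_deriv phi z * v.1 + dotv (space_grad phi z) v.2.
Proof.
move=> dphi; case: v => t x /=.
have -> : (t, x) = t *: (1, 0) + \sum_(i < d) x 0 i *: (0, delta_mx 0 i)
    :> R * 'rV[R]_d.
  rewrite [LHS]surjective_pairing; apply: injective_projections => /=.
    rewrite raddf_sum/= big1 => [|i _]; last by rewrite scaler0.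
    by rewrite addr0 /= [RHS]mulr1.
  by rewrite raddf_sum/= scaler0 add0r [LHS]row_sum_delta.
rewrite /time_deriv !deriveE// linearD linearZ linear_sum /= mulrC; congr (_ + _).
by apply: eq_bigr => i _; rewrite linearZ !mxE /= deriveE// mulrC.
Qed.

Lemma lipschitz_exists_bound {R : realType} {V : normedModType R} (A : set V) (f : V -> R) :
  [lipschitz f z | z in A] ->
  exists2 L : R, 0 < L & forall x y, A x -> A y -> `|f x - f y| <= L * `|x - y|.
Proof.
move=> f_lip; near (pinfty_nbhs R) => L.
exists L; first by near: L; exact: nbhs_pinfty_gt.
move=> x y Ax Ay.
have fL : L.-lipschitz_A f by near: L.
exact: (fL (x, y) (conj Ax Ay)).
Unshelve. all: by end_near. Qed.

Lemma near_open_spacetime {R : realType} {d : nat} (z : R * 'rV[R]_d) :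
  open_spacetime z -> \forall y \near z, open_spacetime y.
Proof.
move=> z_gt0; rewrite /open_spacetime/=.
by apply: (cvgr_gt _ cvg_fst).
Qed.

(** A point at time 0 is a limit of its forward translates in time, which lie in the open
    half-space. This is what later gives subgradients at the initial time. *)
Lemma closed_spacetime_sub_closure_solved {R : realType} {d : nat}
    (H : 'rV[R]_d -> R) (f : R * 'rV[R]_d -> R) :
  satisfies_on_dense_subset H f ->
  @closed_spacetime R d `<=`
    closure [set z | [/\ open_spacetime z, differentiable f z
                       & HJ_residual H f z = 0]].
Proof.
move=> + z z_ge0; rewrite /satisfies_on_dense_subset.
set D := closure _ => f_solves.
have /closure_id -> : closed D by exact: closed_closure.
apply: (closureS f_solves) => B zB.
near ((0 : R)^'+) => s.
exists (s *: (1, 0) + z); split; last by near: s; exact: near_segment.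
rewrite /open_spacetime/= [s *: _]mulr1 ltr_wpDr//.
Unshelve. all: by end_near. Qed.

Lemma lipschitz_within_continuous {R : realType} {V : normedModType R} (A : set V) (f : V -> R) :
  [lipschitz f z | z in A] -> {within A, continuous f}.
Proof.
move=> /lipschitz_exists_bound[L L0 fL]; apply/subspace_continuousP => z Az.
apply/cvgrPdist_le => e e0.
near=> y.
have Ay : A y by near: y; exact: withinT.
apply: le_trans (fL _ _ Az Ay) _.
rewrite -ler_pdivlMl// mulrC.
near: y; apply: cvg_within.
by apply: cvgr_dist_le; [exact: cvg_id|rewrite divr_gt0].
Unshelve. all: by end_near. Qed.

(** * Existence of subgradients of the form (H q, q) *)

Lemma exists_HJ_subgradient {R : realType} {d : nat}
    (H : 'rV[R]_d -> R) (f : R * 'rV[R]_d -> R) :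
  continuous H -> [lipschitz f z | z in @closed_spacetime R d] ->
  convex_function (@closed_spacetime R d) f ->
  satisfies_on_dense_subset H f ->
  forall z, closed_spacetime z -> exists q : 'rV[R]_d,
    forall w, closed_spacetime w ->
      f z + H q * (w.1 - z.1) + dotv q (w.2 - z.2) <= f w.
Proof.
move=> H_cont f_lip f_convex f_solves z0 z0_ge0.
have := closed_spacetime_sub_closure_solved _ _ f_solves _ z0_ge0.
set D := [set z | _] => Dz0.
have D_closed z : D z -> closed_spacetime z by case=> /ltW.
have slopeD z w : D z -> closed_spacetime w ->
    f z + H (space_grad f z) * (w.1 - z.1) + dotv (space_grad f z) (w.2 - z.2)
      <= f w.
  move=> [z_gt0 df eqf] w_ge0.
  have -> : H (space_grad f z) = time_deriv f z by apply/esym/subr0_eq.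
  rewrite -addrA -(derive_spacetime _ z (w - z))//.
  apply: (convex_local_min_subgradient _ _ _ _ _ f_convex) => //.
    exact: ltW.
  by rewrite /local_min_at; near=> y; rewrite !subrr.
have [L L_gt0 fL] := lipschitz_exists_bound _ _ f_lip.
pose M i := L * `|(0, delta_mx 0 i) : R * 'rV[R]_d|.
pose K := [set q : 'rV[R]_d | forall i, `[- M i, M i]%classic (q 0 i)].
have gradK z : D z -> K (space_grad f z).
  move=> Dz i.
  (* A purely spatial increment kills the [H] term, so the Lipschitz constant bounds the spatial
     gradient in each direction. *)
  have bnd (v : 'rV[R]_d) : dotv (space_grad f z) v <= L * `|(0, v) : R * 'rV[R]_d|.
    have zv_ge0 : closed_spacetime (z + (0, v)).
      by rewrite /closed_spacetime/= addr0; exact: D_closed.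
    have := slopeD z _ Dz zv_ge0; rewrite /= addr0 subrr mulr0 addr0.
    rewrite [z.2 + v]addrC addrK -lerBrDl => /le_trans; apply.
    apply: le_trans (ler_norm _) _; apply: le_trans (fL _ _ _ _) _ => //.
      exact: D_closed.
    by rewrite [z + _]addrC addrK.
  have := bnd (delta_mx 0 i); have := bnd (- delta_mx 0 i).
  rewrite dotvNr dotv_delta /= in_itv/= => lo hi.
  apply/andP; split => //; rewrite lerNl; apply: le_trans lo _.
  suff -> : (0, - delta_mx 0 i) = - (0, delta_mx 0 i) :> R * 'rV[R]_d by rewrite normrN.
  by apply: injective_projections; rewrite //= oppr0.
have K_compact : compact K.
  have segM i : compact `[- M i, M i]%classic by exact: segment_compact.
  exact: rV_compact segM.
have FD : ProperFilter (within D (nbhs z0)).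
  exact: within_nbhs_proper.
have [q [_ qF]] : exists q, K q /\ cluster (space_grad f z @[z --> within D (nbhs z0)]) q.
  have [|q [Kq qF]] := K_compact (space_grad f z @[z --> within D (nbhs z0)]) _.
    by apply: filterS gradK _; exact: withinT.
  by exists q.
exists q => w w_ge0; rewrite leNgt; apply/negP => f_lt.
(* The gradients only cluster at [q], so the slope is made a variable independent of the base point.
   If the inequality failed at (z0, q), it would fail by continuity for all pairs near it, and the
   cluster property supplies a pair (z, gradient at z) with [z] in [D] among them. *)
set F := filter_prod (within D (nbhs z0)) (nbhs q).
have cvz : x.1 @[x --> F] --> z0.
  by apply: cvg_trans cvg_fst _; exact: cvg_within.
have cvq : x.2 @[x --> F] --> q by exact: cvg_snd.
have cvf : f x.1 @[x --> F] --> f z0.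
  apply: (cvg_comp _ _ cvg_fst).
  have /subspace_continuousP/(_ _ z0_ge0) := lipschitz_within_continuous _ _ f_lip.
  apply: cvg_trans.
  by apply: cvg_app; apply: within_subset.
have : (f x.1 + H x.2 * (w.1 - x.1.1) + dotv x.2 (w.2 - x.1.2)) @[x --> F] -->
    f z0 + H q * (w.1 - z0.1) + dotv q (w.2 - z0.2).
  apply: cvgD; first (apply: cvgD => //; apply: cvgM).
  - exact: cvg_comp cvq (H_cont q).
  - by apply: cvgB; [exact: cvg_cst|exact: cvg_comp cvz cvg_fst].
  - by apply: cvg_dotv => //; apply: cvgB; [exact: cvg_cst|exact: cvg_comp cvz cvg_snd].
move=> /cvgr_gt/(_ _ f_lt)[[P Q]/= [zP qQ] PQ].
have gradP : nbhs z0 [set z | D z -> (space_grad f @` (D `&` P)) (space_grad f z)].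
  by move: zP; rewrite /within/=; apply: filterS => z zP Dz; exists z => //; split => //; exact: zP.
have [_ [[z [Dz Pz] <-] Qz]] := qF _ _ gradP qQ.
have := PQ (z, space_grad f z) (conj Pz Qz).
by rewrite ltNge slopeD.
Unshelve. all: by end_near. Qed.

(** * Test functions touching from above *)

(** Near [z], [phi] minus its value at [z] dominates the increment of [f], hence the linear form
    given by (H q, q). A linear form below the differential equals it. *)
Lemma local_max_HJ_residual {R : realType} {d : nat} (H : 'rV[R]_d -> R)
    (f phi : R * 'rV[R]_d -> R) (z : R * 'rV[R]_d) (q : 'rV[R]_d) :
  open_spacetime z -> differentiable phi z ->
  local_max_at (fun y => f y - phi y) z ->
  (forall w, closed_spacetime w ->
      f z + H q * (w.1 - z.1) + dotv q (w.2 - z.2) <= f w) ->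
  HJ_residual H phi z = 0.
Proof.
move=> z_gt0 dphi zmax f_ge.
pose l (v : R * 'rV[R]_d) := H q * v.1 + dotv q v.2.
have lE : forall v, 'D_v phi z = l v.
  apply: derive_eq_of_ge => // v; first by rewrite /l/= dotvNr mulrN opprD.
  apply: (derive_ge _ _ _ _ 0); first exact: diff_derivable.
  near=> s.
  have ge0 : closed_spacetime (s *: v + z).
    by apply/ltW; near: s; exact: near_segment (near_open_spacetime _ z_gt0).
  have smax : f (s *: v + z) - phi (s *: v + z) <= f z - phi z.
    by near: s; exact: near_segment zmax.
  have := f_ge _ ge0; rewrite /l /= !addrK dotvZr => fs.
  have -> : s * (H q * v.1 + dotv q v.2 - 0 * s) =
    H q * (s * v.1) + s * dotv q v.2 by ring.
  move: fs smax; rewrite /GRing.scale/=; lra.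
rewrite /HJ_residual /time_deriv lE /l/=.
suff -> : space_grad phi z = q by rewrite dotvr0; ring.
by apply/rowP => i; rewrite mxE lE /l/= mulr0 add0r dotv_delta.
Unshelve. all: by end_near. Qed.

(** * Test functions touching from below, by penalisation at time 0 *)

Lemma penalized_minimizer {R : realType} {d : nat} (F : 'rV[R]_d -> R)
    (p h : 'rV[R]_d) (m eps : R) :
  continuous F -> 0 < eps -> (forall x, m <= F x - dotv p x) ->
  exists y, forall x, F y - dotv p y + eps * dotv (y - h) (y - h) <=
                      F x - dotv p x + eps * dotv (x - h) (x - h).
Proof.
move=> F_cont eps_gt0 m_le.
(* [C] bounds how far the objective can drop below its value at [h] without the penalty. With
   [eps * (r - 1) = C] and [r >= 1], the penalty outside the box of radius [r] is at least
   [eps * r ^+ 2 >= C], so a minimiser over the box is global. *)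
pose C := F h - dotv p h - m.
have C_ge0 : 0 <= C by rewrite subr_ge0.
pose r := C / eps + 1.
have r_ge1 : 1 <= r by rewrite /r lerDr divr_ge0// ltW.
pose A := [set x : 'rV[R]_d | forall i, `[h 0 i - r, h 0 i + r]%classic (x ord0 i)].
have A_compact : compact A.
  have segA i : compact `[h 0 i - r, h 0 i + r]%classic.
    exact: segment_compact.
  exact: rV_compact segA.
have Ah : A h by move=> i; rewrite /= in_itv/=; apply/andP; split; lra.
have u_cont : continuous
    (fun x : 'rV[R]_d => F x - dotv p x + eps * dotv (x - h) (x - h)).
  move=> /= x.
  suff cv (u : 'rV[R]_d) : F y - dotv p y + eps * dotv (y - h) (y - h) @[y --> u] -->
      F u - dotv p u + eps * dotv (u - h) (u - h) by exact: cv.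
  have cvuh : (y - h) @[y --> u] --> u - h by exact: cvgB cvg_id (cvg_cst h).
  have cvp : dotv p y @[y --> u] --> dotv p u.
    exact: (@cvg_dotv _ _ _ (nbhs u) _ _ _ _ _ (cvg_cst p) cvg_id).
  have cvq : eps * dotv (y - h) (y - h) @[y --> u] -->
      eps * dotv (u - h) (u - h).
    exact: cvgM (cvg_cst eps) (cvg_dotv _ _ _ _ cvuh cvuh).
  exact: cvgD (cvgB (F_cont u) cvp) cvq.
have [|y _ ymin] := @EVT_min_rV _ _ _ A _ A_compact (continuous_subspaceT u_cont).
  by exists h.
exists y => x; have [Ax|nAx] := pselect (A x); first exact/ymin/mem_set.
apply: le_trans (ymin h (mem_set Ah)) _.
rewrite subrr dotvr0 mulr0 addr0.
have [i xi] : exists i, ~ (h 0 i - r <= x 0 i <= h 0 i + r).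
  apply: contrapT => nx; apply: nAx => i /=; rewrite in_itv/=.
  by apply: contrapT => xi; apply: nx; exists i.
have r_le : r ^+ 2 <= (x - h) 0 i ^+ 2.
  move/negP : xi; rewrite !mxE negb_and -!ltNge => /orP[] ?; nra.
have Cr : C <= eps * r ^+ 2.
  have -> : C = eps * (r - 1) by rewrite /r; field; exact: lt0r_neq0.
  by rewrite ler_pM2l//; nra.
have := m_le x; have := sqr_coord_le_dotv (x - h) i.
rewrite -(ler_pM2l eps_gt0) => le1 le2.
rewrite -(ler_pM2l eps_gt0) in r_le.
rewrite /C in Cr; lra.
Qed.

(** Here (a, p) plays the gradient of the test function, and [q] is the slope at the minimiser [y]
    of the penalised initial datum. The bound on [q - p] has a constant independent of [eps]. *)
Lemma penalized_HJ_slope {R : realType} {d : nat} (H : 'rV[R]_d -> R)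
    (f : R * 'rV[R]_d -> R) (z : R * 'rV[R]_d) (a eps : R) (p : 'rV[R]_d) :
  (forall y : 'rV[R]_d, differentiable (fun x => f (0, x)) y) ->
  (forall y : 'rV[R]_d, exists q : 'rV[R]_d,
    forall w, closed_spacetime w ->
      f (0, y) + H q * w.1 + dotv q (w.2 - y) <= f w) ->
  0 < z.1 -> 0 < eps ->
  (forall x, f z - a * z.1 + dotv p (x - z.2) <= f (0, x)) ->
  exists q : 'rV[R]_d, H q <= a /\
    forall i, (q 0 i - p 0 i) ^+ 2 <= 4 * eps * (f (0, z.2) - f z + a * z.1).
Proof.
move=> F_diff f_sub z_gt0 eps_gt0 z_sub.
pose F x := f (0, x).
have dotB (x : 'rV[R]_d) : dotv p (x - z.2) = dotv p x - dotv p z.2.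
  by rewrite dotvDr dotvNr.
have [||y ymin] := penalized_minimizer F p z.2
    (f z - a * z.1 - dotv p z.2) eps _ eps_gt0.
- by move=> x; exact: differentiable_continuous (F_diff x).
- by move=> x; have := z_sub x; rewrite dotB /F; lra.
have [q q_sub] := f_sub y.
(* Differentiability of the initial datum forces its gradient at [y] to be the spatial part [q] of
   the subgradient. *)
have DF : forall v, 'D_v F y = dotv q v.
  apply: derive_eq_of_ge => [||v]; [exact: F_diff|exact: dotvNr|].
  apply: (derive_ge _ _ _ _ 0); first exact/diff_derivable/F_diff.
  near=> s.
  have := q_sub (0, s *: v + y) (lexx 0).
  by rewrite /= addrK dotvZr /F; lra.
(* First-order optimality at [y]; the slack [eps * dotv v v] is the second-order term of the
   penalty. Testing against the opposite of the vector itself makes it vanish. *)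
have r_ge0 v : 0 <= dotv (q - p + (2 * eps) *: (y - z.2)) v.
  rewrite !dotvDl dotvZl dotvNl.
  suff : dotv p v - 2 * eps * dotv (y - z.2) v <= 'D_v F y by rewrite DF; lra.
  apply: (derive_ge _ _ _ _ (eps * dotv v v)); first exact/diff_derivable/F_diff.
  near=> s.
  have := ymin (s *: v + y).
  rewrite (_ : s *: v + y - z.2 = s *: v + (y - z.2)); last by rewrite addrA.
  move: (y - z.2) => e; rewrite !dotvDl !dotvDr !dotvZl !dotvZr (dotvC v e).
  lra.
have /dotv_eq0 r_eq0 : dotv (q - p + (2 * eps) *: (y - z.2))
    (q - p + (2 * eps) *: (y - z.2)) <= 0.
  by have := r_ge0 (- (q - p + (2 * eps) *: (y - z.2))); rewrite dotvNr oppr_ge0.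
have qE : q = p - (2 * eps) *: (y - z.2).
  by apply: subr0_eq; rewrite opprB [_ - p]addrC addrA.
exists q; split.
  rewrite -(ler_pM2r z_gt0).
  (* The two subgradient inequalities, from (0, y) to [z] and back, are added; the penalty
     contributes a term of favourable sign. *)
  have := q_sub z (ltW z_gt0); have := z_sub y.
  have -> : dotv q (z.2 - y) = - dotv p (y - z.2) + 2 * eps * dotv (y - z.2) (y - z.2).
    by rewrite -(opprB y) dotvNr {1}qE dotvDl dotvNl dotvZl; ring.
  have := mulr_ge0 (ltW eps_gt0) (dotv_ge0 (y - z.2)); lra.
move=> i.
have -> : q 0 i - p 0 i = - (2 * eps * (y - z.2) 0 i).
  by rewrite qE !mxE; ring.
(* Comparing [y] with the centre [z.2], where the penalty is zero, bounds [eps] times the squared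
   distance uniformly in [eps]. *)
have := ymin z.2; rewrite subrr dotvr0 mulr0 addr0 /F => y_le.
have := z_sub y; rewrite dotB => y_ge.
have e_le : eps * dotv (y - z.2) (y - z.2) <= f (0, z.2) - f z + a * z.1 by lra.
rewrite sqrrN exprMn (_ : (2 * eps) ^+ 2 = 4 * eps * eps); last by ring.
rewrite -[leLHS]mulrA ler_pM2l; last by rewrite mulr_gt0.
apply: le_trans e_le; rewrite ler_pM2l//; exact: sqr_coord_le_dotv.
Unshelve. all: by end_near. Qed.

Lemma le_of_near_coord {R : realType} {d : nat} (H : 'rV[R]_d -> R)
    (p : 'rV[R]_d) (a C : R) :
  {for p, continuous H} -> 0 <= C ->
  (forall eps, 0 < eps -> exists q : 'rV[R]_d, H q <= a /\
    forall i, (q 0 i - p 0 i) ^+ 2 <= 4 * eps * C) ->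
  H p <= a.
Proof.
move=> H_cont C_ge0 q_near; rewrite leNgt; apply/negP => a_lt.
have /nbhs_ballP[e /= e_gt0 H_gt] : \forall q \near p, a < H q.
  exact: cvgr_gt H_cont _ a_lt.
have e2_gt0 : 0 < e ^+ 2 by rewrite exprn_gt0.
(* This choice gives [4 * eps * C < e ^+ 2]; [C + 1] keeps the denominator positive when [C = 0].
   Coordinatewise bounds suffice because balls of row vectors are boxes. *)
have eps_gt0 : 0 < e ^+ 2 / (8 * (C + 1)).
  by rewrite divr_gt0// mulr_gt0// ltr_wpDl.
have [q [Hq_le q_le]] := q_near _ eps_gt0.
have : a < H q.
  apply: H_gt; split=> // j i; rewrite ord1 /ball/= distrC.
  rewrite -(@ltr_pXn2r _ 2)// ?nnegrE ?ltW// real_normK ?num_real//.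
  apply: le_lt_trans (q_le i) _.
  have -> : 4 * (e ^+ 2 / (8 * (C + 1))) * C = e ^+ 2 * (C / (2 * (C + 1))).
    by field; rewrite gt_eqF// ltr_wpDl.
  rewrite gtr_pMr// ltr_pdivrMr; last by rewrite mulr_gt0// ltr_wpDl.
  lra.
by rewrite ltNge Hq_le.
Qed.

Theorem propositionA2 (R : realType) (d : nat)
    (H : 'rV[R]_d -> R) (f : R * 'rV[R]_d -> R)
    (H_smooth : smooth_on setT H)
    (f_lipschitz : [lipschitz f z | z in @closed_spacetime R d])
    (f_convex : convex_function (@closed_spacetime R d) f)
    (f_solves : satisfies_on_dense_subset H f)
    (f_initial_C1 : Ck_on 1 setT (fun x : 'rV[R]_d => f (0, x))) :
  viscosity_solution_with_initial H (fun x : 'rV[R]_d => f (0, x)) f.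
Proof.
have H_cont : continuous H by move=> q; exact: (H_smooth 0%N q I).
have f_cont := lipschitz_within_continuous _ _ f_lipschitz.
have f_sub := exists_HJ_subgradient _ _ H_cont f_lipschitz f_convex f_solves.
have phi_diff (phi : R * 'rV[R]_d -> R) z :
    open_spacetime z -> smooth_on (@open_spacetime R d) phi ->
    differentiable phi z.
  by move=> z_gt0 /(_ 1%N)[+ _]; exact.
split=> //; split; split=> // z phi z_gt0 phi_smooth z_ext.
  have [q q_sub] := f_sub z (ltW z_gt0).
  rewrite (local_max_HJ_residual H f phi z q)//.
  exact: phi_diff.
have dphi := phi_diff _ _ z_gt0 phi_smooth.
(* The gradient of [phi] is a subgradient of [f] at [z], here tested at time 0. *)
have z_sub x : f z - time_deriv phi z * z.1 +
    dotv (space_grad phi z) (x - z.2) <= f (0, x).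
  have := convex_local_min_subgradient _ f phi z (0, x) f_convex (ltW z_gt0)
    (lexx 0) dphi z_ext.
  by rewrite derive_spacetime//=; lra.
rewrite /HJ_residual subr_ge0.
apply: (le_of_near_coord _ _ _ (f (0, z.2) - f z + time_deriv phi z * z.1)).
- exact: H_cont.
- by have := z_sub z.2; rewrite subrr dotvr0; lra.
move=> eps eps_gt0; apply: penalized_HJ_slope => // y.
  by case: f_initial_C1 => + _; exact.
have [q q_sub] := f_sub (0, y) (lexx 0).
by exists q => w /q_sub; rewrite subr0.
Qed.
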